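(* Let $s\in\mathbb{R}$, $s\neq0$, let $f:(0,\infty)\to\mathbb{R}$ be a convex or concave function, and consider $s$-concave functions $\varphi:\mathbb{R}^n\to[0,\infty)$ (all functions involved having the smoothness and integrability stated in the context). (1) $D_f^{(s)}$ is invariant under self-adjoint linear maps in $SL(n)$: for every $s$-concave $\varphi$ and every self-adjoint linear map $A:\mathbb{R}^n\to\mathbb{R}^n$ with $\det A=1$, $D_f^{(s)}(\varphi\circ A)=D_f^{(s)}(\varphi)$. (2) $D_f^{(s)}$ is a valuation: if $\varphi_1,\varphi_2$ are $s$-concave and $\max(\varphi_1,\varphi_2)$ is $s$-concave, then $$D_f^{(s)}(\varphi_1)+D_f^{(s)}(\varphi_2)=D_f^{(s)}(\max(\varphi_1,\varphi_2))+D_f^{(s)}(\min(\varphi_1,\varphi_2)).$$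
   Context: For $s\ne0$, $\varphi:\mathbb{R}^n\to[0,\infty)$ is $s$-concave if $\varphi((1-\lambda)x+\lambda y)\ge\left((1-\lambda)\varphi(x)^s+\lambda\varphi(y)^s\right)^{1/s}$ for all $\lambda\in[0,1]$ and all $x,y$ with $\varphi(x)>0$, $\varphi(y)>0$. $\mathrm{supp}(\varphi)=\{x:\varphi(x)>0\}$. The $f$-divergence of an $s$-concave function $\varphi$ is $$D_f^{(s)}(\varphi)=\int_{\mathrm{supp}(\varphi)}\varphi\; f\!\left(\frac{\det\left[\frac{-\mathrm{Hess}(\varphi)}{\varphi}+(1-s)\frac{\nabla\varphi\otimes\nabla\varphi}{\varphi^2}\right]}{\varphi^2\left(1-s\frac{\langle\nabla\varphi,x\rangle}{\varphi}\right)^{n+\frac1s+1}}\right)\left(1-s\frac{\langle\nabla\varphi,x\rangle}{\varphi}\right)dx,$$ with the convention $f(0)=\lim_{t\downarrow0}f(t)$, $0\cdot\infty=0$. Standing assumption: the functions are integrable, have enough smoothness on their supports ($C^2$), and the integrands are integrable, so that all the expressions considered make sense. *)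

(* Defs.v *)
From HB Require Import structures.
From mathcomp Require Import all_boot all_order all_algebra.
From mathcomp Require Import all_classical all_reals all_analysis.

Set Implicit Arguments.
Unset Strict Implicit.
Unset Printing Implicit Defensive.

Import Order.TTheory GRing.Theory Num.Theory.
Import numFieldNormedType.Exports.

Local Open Scope classical_set_scope.
Local Open Scope ring_scope.

(* R^n is ['rV[R]_n] with the sigma-algebra generated by the coordinates, which
   is the Borel sigma-algebra. *)

Definition measure_rV_display : measure_display -> measure_display.
Proof. exact. Qed.

Section measurable_rV.
Context (R : realType) (n : nat).

Definition rV_coord (i : 'I_n) (x : 'rV[R]_n) : measurableTypeR R := x 0 i.

Let rV_set0 : g_sigma_preimage rV_coord set0.
Proof. exact: sigma_algebra0. Qed.

Let rV_setC A : g_sigma_preimage rV_coord A -> g_sigma_preimage rV_coord (~` A).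
Proof. exact: sigma_algebraC. Qed.

Let rV_bigcup (F : (set 'rV[R]_n)^nat) :
  (forall i, g_sigma_preimage rV_coord (F i)) ->
  g_sigma_preimage rV_coord (\bigcup_i (F i)).
Proof. exact: sigma_algebra_bigcup. Qed.

HB.instance Definition _ :=
  @isMeasurable.Build (measure_rV_display default_measure_display)
    'rV[R]_n (g_sigma_preimage rV_coord) rV_set0 rV_setC rV_bigcup.

End measurable_rV.

Section lebesgue_rV.
Context (R : realType).

Lemma measurable_rV_coord n (i : 'I_n) :
  measurable_fun [set: 'rV[R]_n] (@rV_coord R n i).
Proof.
move=> _ Y mY; rewrite setTI; apply: sub_sigma_algebra => /=.
rewrite -bigcup_seq/=; exists i => /=; first by rewrite mem_index_enum.
by exists Y => //; rewrite setTI.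
Qed.

Lemma measurable_fun_rVP d (T : measurableType d) n (f : T -> 'rV[R]_n) :
  (forall i, measurable_fun [set: T] (@rV_coord R n i \o f)) ->
  measurable_fun [set: T] f.
Proof.
move=> mf.
suff H : g_sigma_preimage (fun i => @rV_coord R n i \o f) `<=` measurable.
  move=> _ A mA; apply: H.
  rewrite (@g_sigma_preimage_comp _ _ n 'rV[R]_n (@rV_coord R n)).
  by exists A.
apply: smallest_sub; first exact: sigma_algebra_measurable.
elim/big_ind : _ => //; first by move=> ? ? ? ?; rewrite subUset.
by move=> i _ A [B mB <-]; exact: mf.
Qed.

Definition rV_cons n (p : measurableTypeR R * 'rV[R]_n) : 'rV[R]_n.+1 :=
  row_mx (p.1%:M : 'rV_1) p.2.

Lemma measurable_rV_cons n : measurable_fun setT (@rV_cons n).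
Proof.
apply: measurable_fun_rVP => i; rewrite /rV_cons.
case: (@split_ordP 1 n i) => j ->.
  rewrite (_ : _ \o _ = fst)//; apply/funext => -[x v]/=.
  by rewrite /rV_coord (row_mxEl (_ : 'rV_1)) mxE !ord1.
rewrite (_ : _ \o _ = @rV_coord R n j \o snd); last first.
  by apply/funext => -[x v]/=; rewrite /rV_coord (row_mxEr (_ : 'rV_1)).
by apply: measurableT_comp => //; exact: measurable_rV_coord.
Qed.

Section rV_cons_measure.
Context (n : nat) (m : {sigma_finite_measure set 'rV[R]_n -> \bar R}).

(* Cavalieri: the slice of [A] at height [x] is measured by [m]. *)
Definition rV_cons_measure (A : set 'rV[R]_n.+1) : \bar R :=
  ((@lebesgue_measure R) \x m)%E (@rV_cons n @^-1` A).

Let mpre (A : set 'rV[R]_n.+1) :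
  measurable A -> measurable (@rV_cons n @^-1` A).
Proof. by move=> mA; rewrite -[X in measurable X]setTI; exact: measurable_rV_cons. Qed.

Let rV_cons_measure0 : rV_cons_measure set0 = 0%E.
Proof. by rewrite /rV_cons_measure preimage_set0 measure0. Qed.

Let rV_cons_measure_ge0 A : (0 <= rV_cons_measure A)%E.
Proof. by []. Qed.

Let rV_cons_measure_sigma_additive : semi_sigma_additive rV_cons_measure.
Proof.
move=> F mF tF mUF; rewrite /rV_cons_measure preimage_bigcup.
apply: measure_semi_sigma_additive.
- by move=> i; exact: mpre.
- apply/trivIsetP => /= i j _ _ ij; rewrite -preimage_setI.
  by move/trivIsetP : tF => /(_ _ _ _ _ ij) ->//; rewrite preimage_set0.
- by rewrite -preimage_bigcup; exact: mpre.
Qed.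

HB.instance Definition _ := isMeasure.Build _ _ _ rV_cons_measure
  rV_cons_measure0 rV_cons_measure_ge0 rV_cons_measure_sigma_additive.

Let rV_cons_measure_sigma_finite : sigma_finite setT rV_cons_measure.
Proof.
have /sigma_finiteP[F [TF ndF Foo]] := sigma_finiteT (@lebesgue_measure R).
have /sigma_finiteP[G [TG ndG Goo]] := sigma_finiteT m.
pose h (x : 'rV[R]_n.+1) : 'rV[R]_n := \row_j rV_coord (rshift 1 j) x.
have mh : measurable_fun setT h.
  apply: measurable_fun_rVP => i.
  rewrite (_ : _ \o _ = rV_coord (rshift 1 i)); first exact: measurable_rV_coord.
  by apply/funext => x; rewrite /= /rV_coord mxE.
exists (fun k => @rV_coord R n.+1 0 @^-1` F k `&` h @^-1` G k).
  apply/seteqP; split => // x _.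
  have [k _ Fk] : (\bigcup_k F k) (rV_coord 0 x) by rewrite -TF.
  have [l _ Gl] : (\bigcup_k G k) (h x) by rewrite -TG.
  exists (maxn k l) => //; split => /=.
    by move: Fk; exact/subsetPset/ndF/leq_maxl.
  by move: Gl; exact/subsetPset/ndG/leq_maxr.
move=> k; have [mFk Fkoo] := Foo k; have [mGk Gkoo] := Goo k; split.
  apply: measurableI; rewrite -[X in measurable X]setTI.
    exact: measurable_rV_coord.
  exact: mh.
rewrite /rV_cons_measure (_ : _ @^-1` _ = F k `*` G k).
  by rewrite product_measure1E// lte_mul_pinfty// ge0_fin_numE.
have E (x : R) (v : 'rV[R]_n) :
    (rV_coord 0 (rV_cons (x, v)) = x) * (h (rV_cons (x, v)) = v).
  split.
    rewrite /rV_coord /rV_cons (_ : 0 = lshift n (0 : 'I_1)); last exact: val_inj.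
    by rewrite (row_mxEl (_ : 'rV_1)) mxE.
  by apply/rowP => j; rewrite mxE /rV_coord /rV_cons (row_mxEr (_ : 'rV_1)).
by apply/seteqP; split => -[x v] /=; rewrite !E.
Qed.

HB.instance Definition _ := Measure_isSigmaFinite.Build _ _ _ rV_cons_measure
  rV_cons_measure_sigma_finite.

End rV_cons_measure.

Fixpoint lebesgue_rV (n : nat) : {sigma_finite_measure set 'rV[R]_n -> \bar R} :=
  match n with
  | 0 => dirac (0 : 'rV[R]_0)
  | k.+1 => rV_cons_measure (lebesgue_rV k)
  end.

Lemma lebesgue_rV_box n (A : 'I_n -> set (measurableTypeR R)) :
  (forall i, measurable (A i)) ->
  lebesgue_rV n [set x | forall i, A i (x 0 i)] =
  (\prod_(i < n) lebesgue_measure (A i))%E.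
Proof.
elim: n A => [|n IHn] A mA.
  rewrite big_ord0 /= diracE mem_set// => -[].
  by [].
rewrite big_ord_recl -IHn//= /rV_cons_measure.
set B := [set x : 'rV[R]_n | forall i : 'I_n, A (lift ord0 i) (x 0 i)].
have mB : measurable B.
  rewrite (_ : B = \bigcap_(i in [set: 'I_n])
      (@rV_coord R n i @^-1` A (lift ord0 i))); last first.
    by apply/seteqP; split => [x Bx i _|x Bx i]; [exact: Bx|exact: (Bx i)].
  apply: fin_bigcap_measurable => // i _.
  by rewrite -[X in measurable X]setTI; exact: measurable_rV_coord.
rewrite -[RHS]product_measure1E//; congr ((lebesgue_measure \x lebesgue_rV n)%E _).
have E0 (x : R) (v : 'rV[R]_n) : rV_cons (x, v) 0 ord0 = x.
  rewrite /rV_cons (_ : ord0 = lshift n (0 : 'I_1)); last exact: val_inj.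
  by rewrite (row_mxEl (_ : 'rV_1)) mxE.
have EL (x : R) (v : 'rV[R]_n) i : rV_cons (x, v) 0 (lift ord0 i) = v 0 i.
  rewrite /rV_cons (_ : lift ord0 i = rshift 1 i); last exact: val_inj.
  by rewrite (row_mxEr (_ : 'rV_1)).
apply/seteqP; split => -[x v] /=.
  move=> H; split=> [|i]; first by have := H ord0; rewrite E0.
  by have := H (lift ord0 i); rewrite EL.
move=> [Ax Bv] i; case: (unliftP ord0 i) => [j|] ->; last by rewrite E0.
by rewrite EL; exact: Bv.
Qed.

End lebesgue_rV.

Section divergence.
Context (R : realType) (n : nat).
Implicit Types (s t : R) (f : R -> R) (phi : 'rV[R]_n -> R) (x : 'rV[R]_n).

Definition dot (u v : 'rV[R]_n) : R := \sum_(i < n) u 0 i * v 0 i.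

Definition self_adjoint (A : {linear 'rV[R]_n -> 'rV[R]_n}) :=
  forall u v, dot (A u) v = dot u (A v).

(* [lin1_mx A] is the matrix of [A], acting on row vectors from the right. *)
Definition det_linear (A : {linear 'rV[R]_n -> 'rV[R]_n}) : R :=
  \det (lin1_mx A).

Definition pderive (i : 'I_n) phi : 'rV[R]_n -> R :=
  fun x => 'D_(delta_mx 0 i) phi x.

Definition gradient phi x : 'rV[R]_n := \row_i pderive i phi x.

Definition hessian phi x : 'M[R]_n :=
  \matrix_(i, j) pderive j (pderive i phi) x.

Definition C2_on (U : set 'rV[R]_n) phi :=
  forall x, U x -> [/\ differentiable phi x, differentiable (gradient phi) x &
                       {for x, continuous (hessian phi)}].

Definition supp phi : set 'rV[R]_n := [set x | 0 < phi x].

Definition s_concave s phi :=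
  (forall x, 0 <= phi x) /\
  forall (l : R) x y, 0 <= l <= 1 -> 0 < phi x -> 0 < phi y ->
    ((1 - l) * phi x `^ s + l * phi y `^ s) `^ s^-1 <=
    phi ((1 - l) *: x + l *: y).

Definition convex_or_concave f :=
  convex_function (`]0, +oo[%classic : set R) f \/
  convex_function (`]0, +oo[%classic : set R) (fun t => - f t).

(* [f] matters on ]0, +oo[ only; its value at 0 is its limit there, which may be
   infinite. *)
Definition ext0 f t : \bar R :=
  if 0 < t then (f t)%:E else lim ((f u)%:E @[u --> 0^'+]).

Definition weight s phi x : R := 1 - s * (dot (gradient phi x) x / phi x).

Definition curvature_mx s phi x : 'M[R]_n :=
  (phi x)^-1 *: (- hessian phi x) +
  ((1 - s) / phi x ^+ 2) *: ((gradient phi x)^T *m gradient phi x).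

(* [a `^ e] is the real power when [0 < a], the only case in which the power is
   meaningful for an arbitrary exponent; it is a default value when [a < 0]. *)
Definition density_ratio s phi x : R :=
  \det (curvature_mx s phi x) /
  (phi x ^+ 2 * weight s phi x `^ (n%:R + s^-1 + 1)).

(* The product is taken in the extended reals, where 0 * +oo = 0. *)
Definition fdiv_integrand s f phi x : \bar R :=
  ((phi x)%:E * ext0 f (density_ratio s phi x) * (weight s phi x)%:E)%E.

Definition fdiv s f phi : \bar R :=
  (\int[lebesgue_rV R n]_(x in supp phi) fdiv_integrand s f phi x)%E.

(* Smoothness is only asked in the interior of the support: what is left of the
   support of an s-concave function is Lebesgue negligible. *)
Definition regular s f phi :=
  [/\ (lebesgue_rV R n).-integrable setT (EFin \o phi),
      C2_on (supp phi)° phi &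
      (lebesgue_rV R n).-integrable (supp phi) (fdiv_integrand s f phi)].

End divergence.

(* Main.v *)
From HB Require Import structures.
Require Import Defs.
From mathcomp Require Import all_boot all_order all_algebra fingroup perm.
From mathcomp Require Import all_classical all_reals all_analysis.
From mathcomp Require Import measurable_realfun ring lra.

(** The two identities are pointwise identities between integrands, valid off a
null set, followed by elementary properties of the integral.

The null set is the frontier of the supports, which are convex because [phi] is
[s]-concave. The frontier of a convex set is porous: when a cube is cut into
[9 ^ n] subcubes, either the set meets all the corners of the cube, and then it
contains its middle ([convex_corners]), or it misses a corner; so at least one
of the subcubes does not meet the frontier ([frontier_porous]). Iterating, the
frontier is covered by arbitrarily small volumes ([negligible_frontier]). Since
derivatives are meaningless on the frontier, the integrands are out of control
there, and need not be measurable; their integrals are nevertheless insensitive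
to null sets ([eq_integral_null]).

Invariance. In the interior of the support, the chain rule gives
  [gradient (phi \o A) x = gradient phi (A x) *m M^T] and
  [hessian (phi \o A) x = M *m hessian phi (A x) *m M^T],
with [M] the matrix of [A]. The matrix [C] inside the determinant becomes
[M *m C *m M^T], and the weight is unchanged as [<g M^T, x> = <g, x M>].
With [\det M = 1], the integrand of [phi \o A] at [x] is that of [phi] at [A x]
([fdiv_integrand_comp_linear]), and it remains to see that [A] preserves
Lebesgue measure. More generally an invertible matrix
multiplies volumes by the absolute value of its determinant
([scales_lebesgue_unit]): for a lower triangular matrix by Fubini and induction
on the dimension, for a permutation matrix because Lebesgue measure is
determined by its values on boxes, and in general by LUP decomposition.

Valuation. Off the frontiers a point is interior or exterior to each support.
If it is exterior to one of them, the minimum vanishes there and the maximum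
coincides with the other function in a neighbourhood. If it is interior to
both, then the jets of order two of the maximum and of the minimum are, in some
order, those of [phi1] and [phi2] ([jet_max_min]). This is clear where [phi1]
and [phi2] differ; it extends by continuity of the derivatives to the closure
of the set where [phi2 < phi1], and outside of this closure [phi1 <= phi2] in a
neighbourhood. The sums of the two integrands thus agree almost everywhere. *)

Set Implicit Arguments.
Unset Strict Implicit.
Unset Printing Implicit Defensive.

Import Order.TTheory GRing.Theory Num.Theory.
Import numFieldNormedType.Exports.

Local Open Scope classical_set_scope.
Local Open Scope ring_scope.

(** * Lebesgue measure and linear maps *)

(** The image measure under [f], packed with the measurability of [f], which
    unification cannot guess from [f]. *)
Definition pushforward_measure d d' (T1 : measurableType d)
    (T2 : measurableType d') (R : realType) (m : {measure set T1 -> \bar R})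
    (f : T1 -> T2) (mf : measurable_fun setT f) : {measure set T2 -> \bar R} :=
  measure_function_pushforward__canonical__measure_function_Measure m mf.

Section linear_change_of_variables.
Context {R : realType}.
Local Notation mu n := (lebesgue_rV R n).

Definition rV_box n (A : 'I_n -> set (measurableTypeR R)) : set 'rV[R]_n :=
  [set x | forall i, A i (x 0 i)].

Lemma measurable_rV_box n (A : 'I_n -> set (measurableTypeR R)) :
  (forall i, measurable (A i)) -> measurable (rV_box A).
Proof.
move=> mA; rewrite (_ : rV_box A = \bigcap_(i in [set: 'I_n])
    (@rV_coord R n i @^-1` A i)); last first.
  by apply/seteqP; split => [x Ax i _|x Ax i]; [exact: Ax|exact: (Ax i)].
apply: fin_bigcap_measurable => // i _.
by rewrite -[X in measurable X]setTI; exact: measurable_rV_coord.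
Qed.

(** Boxes form a pi-system generating the sigma-algebra. *)
Lemma lebesgue_rV_unique n (m : {measure set 'rV[R]_n -> \bar R}) :
  (forall A : 'I_n -> set (measurableTypeR R), (forall i, measurable (A i)) ->
     m (rV_box A) = (\prod_(i < n) lebesgue_measure (A i))%E) ->
  forall B, measurable B -> mu n B = m B.
Proof.
move=> mE B mB.
pose G := [set C : set 'rV[R]_n | exists2 A : 'I_n -> set (measurableTypeR R),
  (forall i, measurable (A i)) & C = rV_box A].
pose g (k : nat) := rV_box (fun _ : 'I_n =>
  (`]- k%:R, k%:R[%classic : set (measurableTypeR R))).
apply: (@measure_unique _ _ _ G g) => //.
- apply/seteqP; split.
    apply: smallest_sub; first exact: smallest_sigma_algebra.
    move=> C; rewrite -bigcup_seq => -[i _ [Y mY <-]].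
    apply: sub_sigma_algebra.
    exists (fun j => if j == i then Y else setT); first by move=> j; case: ifP.
    rewrite setTI; apply/seteqP; split=> x /=.
      by move=> Yx j; case: eqP => // ->.
    by move=> /(_ i); rewrite eqxx.
  apply: smallest_sub; first exact: sigma_algebra_measurable.
  by move=> C [A mA ->]; exact: measurable_rV_box.
- move=> C D [A mA ->] [A' mA' ->]; exists (fun i => A i `&` A' i).
    by move=> i; exact: measurableI.
  apply/seteqP; split=> x /=; first by move=> [? ?] i; split.
  by move=> AA'; split=> i; have [] := AA' i.
- by move=> k; exists (fun=> `]- k%:R, k%:R[%classic).
- apply/seteqP; split=> // x _.
  exists (Num.truncn `|x|).+1 => //= i; rewrite /= in_itv/= -ltr_norml.
  apply: le_lt_trans (truncnS_gt _).
  rewrite [leRHS]/Num.norm/= mx_normrE.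
  by rewrite (le_trans _ (le_bigmax _ _ (0, i))).
- by move=> C [A mA ->]; rewrite mE//; exact: lebesgue_rV_box.
- move=> k; rewrite [ltLHS]lebesgue_rV_box//.
  set P := (X in (X < _)%E); suff /andP[] : (0%E <= P < +oo)%E by [].
  rewrite /P; elim/big_ind : _ => //; first by rewrite lee_fin ler01 ltry.
    move=> a b /andP[a0 aoo] /andP[b0 boo]; rewrite mule_ge0//=.
    by rewrite lte_mul_pinfty// ge0_fin_numE.
  move=> i _; rewrite measure_ge0 lebesgue_measure_itv/=; case: ifP => // _.
    by rewrite -EFinB ltry.
Qed.

Lemma measurable_mulmx n p (M : 'M[R]_(n, p)) :
  measurable_fun setT (fun x : 'rV[R]_n => x *m M : 'rV[R]_p).
Proof.
apply: measurable_fun_rVP => j.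
rewrite (_ : _ \o _ = fun x : 'rV[R]_n => \sum_i rV_coord i x * M i j).
  apply: measurable_sum => i; apply: measurable_funM => //.
  exact: measurable_rV_coord.
by apply/funext => x; rewrite /= /rV_coord mxE.
Qed.

Lemma lebesgue_measure_affine (a b : R) (B : set (measurableTypeR R)) :
  a != 0 -> measurable B ->
  lebesgue_measure ((fun x : measurableTypeR R =>
    (a * x + b : measurableTypeR R)) @^-1` B) =
  (`|a|^-1%:E * lebesgue_measure B)%E.
Proof.
move=> a0 mB.
pose T (x : measurableTypeR R) : measurableTypeR R := a * x + b.
have mT : measurable_fun setT T.
  by apply: measurable_funD => //; exact: measurable_funM.
have na : 0 <= `|a| by [].
pose m := mscale (NngNum na) (pushforward_measure (@lebesgue_measure R) mT).
suff -> : lebesgue_measure B = m B.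
  rewrite /m /= /mscale/= muleA -EFinM mulVf ?mul1e//.
  by rewrite normr_eq0.
apply: lebesgue_measure_unique => // _ [[u v] _ <-]/=.
rewrite lebesgue_measure_itv/= /m /mscale/= /pushforward/=.
have [agt0|alt0] : 0 < a \/ a < 0 by apply/orP; rewrite lt_total// eq_sym.
- rewrite (_ : T @^-1` _ = `](u - b) / a, (v - b) / a]%classic).
    rewrite lebesgue_measure_itv/= !lte_fin ltr_pM2r ?invr_gt0// ltrD2r.
    case: ifPn => uv; last by rewrite mule0.
    rewrite -!EFinB -EFinM; congr EFin.
    by rewrite gtr0_norm//; field.
  apply/seteqP; split => x /=; rewrite !in_itv/= /T ltr_pdivrMr// ler_pdivlMr//;
  by rewrite ltrBlDr lerBrDr (mulrC x).
- rewrite (_ : T @^-1` _ = `[(v - b) / a, (u - b) / a[%classic).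
    rewrite lebesgue_measure_itv/= !lte_fin ltr_nM2r ?invr_lt0// ltrD2r.
    case: ifPn => uv; last by rewrite mule0.
    rewrite -!EFinB -EFinM; congr EFin.
    by rewrite ltr0_norm//; field.
  apply/seteqP; split => x /=; rewrite !in_itv/= /T ltr_ndivlMr// ler_ndivrMr//;
  by rewrite ltrBlDr lerBrDr (mulrC x) andbC.
Qed.

Definition scales_lebesgue n (M : 'M[R]_n) := forall B, measurable B ->
  mu n ((fun x => x *m M) @^-1` B) = (`|\det M|^-1%:E * mu n B)%E.

Lemma scales_lebesgueM n (M N : 'M[R]_n) :
  scales_lebesgue M -> scales_lebesgue N -> scales_lebesgue (M *m N).
Proof.
move=> sM sN B mB.
rewrite (_ : _ @^-1` _ = (fun x => x *m M) @^-1` ((fun x => x *m N) @^-1` B)).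
  rewrite sM ?sN ?muleA -?EFinM -?invfM ?det_mulmx ?normrM//.
  by rewrite -[X in measurable X]setTI; exact: measurable_mulmx.
by apply/seteqP; split => x /=; rewrite mulmxA.
Qed.

Lemma scales_lebesgue_perm n (s : {perm 'I_n}) : scales_lebesgue (perm_mx s).
Proof.
move=> B mB; rewrite det_perm normrX normrN1 expr1n invr1 mul1e.
have mT := @measurable_mulmx n n (perm_mx s).
apply/esym/(@lebesgue_rV_unique n (pushforward_measure (mu n) mT)) => // A mA.
rewrite /= /pushforward (reindex_inj (@perm_inj _ s))/=.
rewrite -[RHS]lebesgue_rV_box//; congr (lebesgue_rV R n _).
have E (x : 'rV[R]_n) i : (x *m perm_mx s) 0 i = x 0 (s^-1 i)%g.
  by rewrite -{1}[s]invgK -col_permE mxE.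
apply/seteqP; split => x /= Ax i; last first.
  by rewrite E; have := Ax (s^-1 i)%g; rewrite permKV.
by have := Ax (s i); rewrite E permK.
Qed.

(** For fixed last coordinates the map is affine in the first one, and [M] acts
    on the last ones: in Fubini's theorem, the first coordinate is integrated
    first. *)
Lemma scales_lebesgue_lblock n (a : R) (c : 'M[R]_(n, 1)) (M : 'M[R]_n) :
  a != 0 -> scales_lebesgue M ->
  scales_lebesgue (block_mx (a%:M : 'M[R]_1) 0 c M).
Proof.
move=> a0 sM B mB; rewrite (@det_lblock _ 1) det_scalar1 normrM invfM EFinM.
have mT := @measurable_mulmx n n M.
set T := fun x : 'rV[R]_n.+1 => _.
pose X := @rV_cons R n @^-1` B.
have mX : measurable X.
  by rewrite -[X in measurable X]setTI; exact: measurable_rV_cons.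
have mY : measurable (@rV_cons R n @^-1` (T @^-1` B)).
  rewrite -[X in measurable X]setTI; apply: measurable_rV_cons => //.
  by rewrite -[X in measurable X]setTI; exact: measurable_mulmx.
have E Y : measurable Y -> (lebesgue_measure \x mu n)%E Y =
    (\int[mu n]_v lebesgue_measure (ysection Y v))%E.
  move=> ?.
  have := @product_measure_unique _ _ _ _ _ (@lebesgue_measure R) (mu n)
    (product_measure2 (@lebesgue_measure R) (mu n)).
  by apply => // ? ? ? ?; exact: product_measure2E.
rewrite /= /rV_cons_measure [LHS]E// [in RHS]E//.
have Tcons x v : T (rV_cons (x, v)) = rV_cons (a * x + (v *m c) 0 0, v *m M).
  rewrite /T /rV_cons/= (@mul_row_block _ _ 1 n 1 n) mulmx0 add0r.
  congr (row_mx _ _); apply/matrixP => i j.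
  by rewrite !ord1 mul_mx_scalar !mxE eqxx !mulr1n.
under eq_integral => v _.
  rewrite (_ : ysection _ _ = (fun x : measurableTypeR R =>
     (a * x + (v *m c) 0 0 : measurableTypeR R)) @^-1` (ysection X (v *m M))).
    rewrite lebesgue_measure_affine//; last exact: measurable_ysection.
    over.
  by rewrite !ysectionE; apply/seteqP; split => x /=; rewrite /X /= Tcons.
have mI : measurable_fun setT (fun v => lebesgue_measure (ysection X v)).
  by have := measurable_fun_ysection (@lebesgue_measure R) mX.
rewrite ge0_integralZl//; last exact: (measurableT_comp mI mT).
rewrite -muleA; congr (_ * _)%E.
(* The image of Lebesgue measure by [M] is a multiple of Lebesgue measure. *)
rewrite -[LHS](@ge0_integral_pushforward _ _ _ _ _ _ mT (mu n) setT
  (fun v => lebesgue_measure (ysection X v)))//.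
have dM : 0 <= `|\det M|^-1 by [].
rewrite -(@ge0_integral_mscale _ _ _ (mu n) setT measurableT (NngNum dM))//.
by apply: eq_measure_integral => A mA _; exact: sM.
Qed.

Lemma scales_lebesgue_trig n (M : 'M[R]_n) :
  is_trig_mx M -> \det M != 0 -> scales_lebesgue M.
Proof.
elim: n M => [|n IHn] M trM.
  move=> _ B mB; rewrite det_mx00 normr1 invr1 mul1e; congr (lebesgue_rV R _ _).
  by apply/seteqP; split=> x /=; rewrite [x *m M]thinmx0 [x]thinmx0.
move: M trM; rewrite -[n.+1]/(1 + n)%N => M.
rewrite -[M]submxK is_trig_block_mx// => /and3P[/eqP -> _ trM].
rewrite [ulsubmx M]mx11_scalar det_lblock det_scalar1 mulf_eq0 negb_or.
by move=> /andP[a0 dM]; apply: scales_lebesgue_lblock => //; exact: IHn.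
Qed.

(** An invertible matrix is, up to permutations of the coordinates, a product of
    two lower triangular ones: LUP decomposition, where reversing the order of
    the coordinates exchanges upper and lower triangular matrices. *)
Lemma scales_lebesgue_unit n (M : 'M[R]_n) : \det M != 0 -> scales_lebesgue M.
Proof.
case: n M => [M|n M] dM.
  by apply: scales_lebesgue_trig => //; apply/is_trig_mxP; case.
have := cormen_lup_correct M; have := cormen_lup_perm M.
have := cormen_lup_detL M; have := @cormen_lup_lower _ _ M.
have := @cormen_lup_upper _ _ M.
case: (cormen_lup M) => -[P L] U/= Uup Llo dL /is_perm_mxP[s Ps] PM.
pose r : 'S_n.+1 := perm (@rev_ord_inj n.+1).
have rr : (perm_mx r *m perm_mx r = 1%:M :> 'M[R]_n.+1).
  rewrite -perm_mxM (_ : r * r = 1)%g ?perm_mx1//.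
  by apply/permP => i; rewrite permM !permE rev_ordK.
have ME : M = perm_mx s^-1 *m L *m
    (perm_mx r *m (perm_mx r *m U *m perm_mx r) *m perm_mx r).
  rewrite -!mulmxA rr mulmx1 (mulmxA (perm_mx r) (perm_mx r)) rr mul1mx.
  rewrite -[L *m U]PM Ps -[_ * M]/(_ *m M) mulmxA -perm_mxM.
  by rewrite mulVg perm_mx1 mul1mx.
have rUr i j : (perm_mx r *m U *m perm_mx r) i j = U (rev_ord i) (rev_ord j).
  have r1 : (r^-1 = r)%g.
    apply/eqP; rewrite eq_invg_mul; apply/eqP/permP => k.
    by rewrite permM !permE rev_ordK.
  by rewrite -row_permE -[X in _ *m perm_mx X]r1 -col_permE !mxE !permE.
have dW : \det (perm_mx r *m U *m perm_mx r) != 0.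
  apply: contraNneq dM => dW.
  rewrite ME det_mulmx [X in _ * X]det_mulmx [X in _ * (X * _)]det_mulmx dW.
  by rewrite mulr0 mul0r mulr0.
rewrite ME; apply: scales_lebesgueM; apply: scales_lebesgueM.
- exact: scales_lebesgue_perm.
- apply: scales_lebesgue_trig; last by rewrite dL oner_neq0.
  by apply/is_trig_mxP => i j ij; rewrite Llo 1?ltnW// -val_eqE ltn_eqF.
- apply: scales_lebesgueM; first exact: scales_lebesgue_perm.
  apply: scales_lebesgue_trig => //; apply/is_trig_mxP => i j ij.
  rewrite rUr Uup//; apply: ltn_sub2l => //.
  exact: leq_ltn_trans ij (ltn_ord j).
- exact: scales_lebesgue_perm.
Qed.

End linear_change_of_variables.

(** * The frontier of a convex set *)

Section convex_frontier.
Context {R : realType} {n : nat}.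
Implicit Types (C : set 'rV[R]_n) (x a : 'rV[R]_n) (r : R).

Definition frontier C := closure C `\` C°.

Lemma convex_setP C : convex_set (C : set (convex_lmodType 'rV[R]_n)) <->
  forall (l : R) x y, 0 <= l <= 1 -> C x -> C y -> C ((1 - l) *: x + l *: y).
Proof.
have convE (l : {i01 R}) (x y : convex_lmodType 'rV[R]_n) :
  conv l x y = l%:num *: (x : 'rV[R]_n) + (1 - l%:num) *: (y : 'rV[R]_n) by [].
split=> [cC l x y /andP[l0 l1] Cx Cy|cC x y l].
  have l0' : 0 <= 1 - l by rewrite subr_ge0.
  have l1' : 1 - l <= 1 by rewrite gerBl.
  have := cC x y (Itv01 l0' l1'); rewrite !inE => /(_ Cx Cy).
  by rewrite convE/= subKr.
rewrite !inE convE => Cx Cy.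
have := cC (1 - l%:num) x y; rewrite subKr; apply=> //.
by rewrite subr_ge0 gerBl ge0 le1.
Qed.

(** A convex set with a point in each corner of a box contains the middle of the
    box: the coordinates are adjusted to those of [y] one after the other, each
    time by a convex combination of two points lying on opposite sides of it. *)
Lemma convex_corners C (a b y : 'rV[R]_n) :
  convex_set (C : set (convex_lmodType 'rV[R]_n)) ->
  (forall e : 'I_n -> bool, exists2 x, C x &
     forall i, if e i then b 0 i <= x 0 i else x 0 i <= a 0 i) ->
  (forall i, a 0 i <= y 0 i <= b 0 i) -> C y.
Proof.
move=> /convex_setP cC corner aby.
(* Once the first [k] coordinates are adjusted, there is still a point of [C]
   for each choice [e] of a corner in the remaining coordinates. *)
suff H k : (k <= n)%N -> forall e : 'I_n -> bool, exists2 x, C x &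
    forall i : 'I_n, if (i < k)%N then x 0 i = y 0 i else
      if e i then b 0 i <= x 0 i else x 0 i <= a 0 i.
  have [x Cx xy] := H n (leqnn n) (fun=> true).
  suff <- : x = y by [].
  by apply/rowP => i; have := xy i; rewrite ltn_ord.
elim: k => [_ e|k IHk kn e]; first exact: corner.
pose j := Ordinal kn.
have [p Cp px] := IHk (ltnW kn) (fun i => if i == j then false else e i).
have [q Cq qx] := IHk (ltnW kn) (fun i => if i == j then true else e i).
have pj : p 0 j <= y 0 j.
  have := px j; rewrite ltnn eqxx => /le_trans; apply.
  by have /andP[] := aby j.
have qj : y 0 j <= q 0 j.
  have := qx j; rewrite ltnn eqxx; apply: le_trans.
  by have /andP[] := aby j.
have [l /[dup] l01 /andP[l0 l1] lE] :
    exists2 l, 0 <= l <= 1 & (1 - l) * p 0 j + l * q 0 j = y 0 j.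
  have [pq|pq] := eqVneq (p 0 j) (q 0 j).
    exists 0; first by rewrite lexx ler01.
    by rewrite subr0 mul1r mul0r addr0; apply/eqP; rewrite eq_le pj pq qj.
  have pq0 : 0 < q 0 j - p 0 j.
    by rewrite subr_gt0 lt_neqAle pq (le_trans pj).
  exists ((y 0 j - p 0 j) / (q 0 j - p 0 j)).
    rewrite divr_ge0 ?subr_ge0 ?(le_trans pj)//= ler_pdivrMr// mul1r.
    by rewrite lerB.
  by field; rewrite gt_eqF.
exists ((1 - l) *: p + l *: q); first exact: cC.
move=> i; rewrite !mxE ltnS.
have [ij|ij] := eqVneq i j; first by rewrite ij /= leqnn.
have -> : (i <= k)%N = (i < k)%N.
  by rewrite leq_eqVlt (negPf (ij : nat_of_ord i != k)).
have := px i; have := qx i; rewrite (negPf ij).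
case: ifP => _; first by move=> -> ->; ring.
by case: ifP => _ qi pi; nra.
Qed.

Definition cube a r : set 'rV[R]_n :=
  [set x | forall i, a 0 i <= x 0 i < a 0 i + r].

Lemma measurable_cube a r : measurable (cube a r).
Proof.
rewrite (_ : cube a r = rV_box (fun i => `[a 0 i, a 0 i + r[%classic)).
  exact: measurable_rV_box.
by apply/seteqP; split => x /= xa i; have := xa i; rewrite /= in_itv.
Qed.

Lemma lebesgue_cube a r : 0 < r -> lebesgue_rV R n (cube a r) = (r ^+ n)%:E.
Proof.
move=> r0.
rewrite (_ : cube a r = rV_box (fun i => `[a 0 i, a 0 i + r[%classic)).
  rewrite [LHS]lebesgue_rV_box//.
  rewrite (eq_bigr (fun=> r%:E)) ?prodEFin ?prodr_const ?card_ord// => i _.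
  rewrite lebesgue_measure_itv/= lte_fin ltrDl r0 -EFinB.
  by congr EFin; rewrite addrC addKr.
by apply/seteqP; split => x /= xa i; have := xa i; rewrite /= in_itv.
Qed.

(** Nine pieces in each direction: three near each end and three in the middle,
    so that the central piece of three has a margin on both sides. *)
Definition subcube_corner a r (k : {ffun 'I_n -> 'I_9}) : 'rV[R]_n :=
  \row_i (a 0 i + r * (k i)%:R / 9).

Lemma cube_subdivision a r x : 0 < r -> cube a r x ->
  exists k, cube (subcube_corner a r k) (r / 9) x.
Proof.
move=> r0 ax.
have k_ex i : exists m : 'I_9,
    a 0 i + r * m%:R / 9 <= x 0 i < a 0 i + r * m%:R / 9 + r / 9.
  have /andP[axi xar] := ax i.
  pose t := (x 0 i - a 0 i) / r * 9.
  have t0 : 0 <= t by rewrite mulr_ge0// divr_ge0 ?subr_ge0// ltW.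
  have tE : x 0 i = a 0 i + r * t / 9 by rewrite /t; field; rewrite gt_eqF.
  have /andP[mt tm] := truncn_itv t0.
  have m9 : (Num.truncn t < 9)%N.
    rewrite -(ltr_nat R); apply: le_lt_trans mt _.
    rewrite /t -ltr_pdivlMr// ltr_pdivrMr//; lra.
  exists (Ordinal m9); rewrite /= tE; rewrite -natr1 in tm.
  by apply/andP; split; nra.
have [k kE] := choice k_ex.
by exists [ffun i => k i] => i; rewrite !mxE ffunE.
Qed.

(** If each corner of the cube meets [C], then the central subcube is in the
    interior of [C]; otherwise a subcube of an empty corner is in the
    exterior. *)
Lemma frontier_porous C a r :
  convex_set (C : set (convex_lmodType 'rV[R]_n)) -> 0 < r ->
  exists k, cube (subcube_corner a r k) (r / 9) `&` frontier C = set0.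
Proof.
move=> cC r0.
have r9 : 0 < r / 9 by rewrite divr_gt0.
pose corner (e : 'I_n -> bool) x := forall i : 'I_n,
  if e i then a 0 i + r * 6 / 9 < x 0 i else x 0 i < a 0 i + r * 3 / 9.
have [full|/existsNP[e empty]] :=
  pselect (forall e, exists2 x, C x & corner e x).
  exists [ffun=> @inord 8 4]; apply/seteqP; split=> // x [xa [_ []]].
  apply: (@filterS _ _ _ (ball x (r / 9))); last exact: nbhsx_ballx.
  move=> y [_ xy]; apply: (@convex_corners C
    (\row_i (a 0 i + r * 3 / 9)) (\row_i (a 0 i + r * 6 / 9))) => //.
    move=> e; have [z Cz ez] := full e; exists z => // i; rewrite !mxE.
    by have := ez i; case: ifP => _ /ltW.
  move=> i; have := xa i; have := xy 0 i; rewrite !mxE ffunE inordK//.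
  by rewrite /ball/= ltr_norml => /andP[? ?] /andP[? ?]; apply/andP; split; lra.
exists [ffun i => @inord 8 (if e i then 7 else 1)].
apply/seteqP; split=> // x [xa [clC _]].
have [y [Cy [_ xy]]] := clC _ (nbhsx_ballx x (r / 9) r9).
apply: empty; exists y => // i.
have := xa i; have := xy 0 i; rewrite !mxE ffunE inordK; last by case: ifP.
rewrite /ball/= ltr_norml.
by case: ifP => _ /andP[? ?] /andP[? ?]; lra.
Qed.

End convex_frontier.

Lemma measure_bigsetU_le d (T : measurableType d) (R : realType)
    (mu : {measure set T -> \bar R}) (I : finType) (P : pred I)
    (F : I -> set T) :
  (forall i, measurable (F i)) ->
  measurable (\big[setU/set0]_(i | P i) F i) /\
  (mu (\big[setU/set0]_(i | P i) F i) <= \sum_(i | P i) mu (F i))%E.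
Proof.
move=> mF; elim/big_rec2 : _ => [|i A y _ [mA Ay]]; first by rewrite measure0.
split; first exact: measurableU.
by apply: le_trans (measureU2 _ _ _) _ => //; rewrite leeD2l.
Qed.

Section null_frontier.
Context {R : realType} {n : nat}.
Implicit Types (C : set 'rV[R]_n) (a : 'rV[R]_n) (r : R).
Local Notation mu := (lebesgue_rV R n).

(** Porosity makes the volume shrink by a constant factor each time that the
    grid is refined. *)
Lemma frontier_cover C : convex_set (C : set (convex_lmodType 'rV[R]_n)) ->
  forall (j : nat) a r, 0 < r -> exists B, [/\ measurable B,
    frontier C `&` cube a r `<=` B &
    (mu B <= ((1 - (9 ^+ n)^-1) ^+ j * r ^+ n)%:E)%E].
Proof.
move=> cC; elim=> [|j IHj] a r r0.
  exists (cube a r); split; [exact: measurable_cube|by move=> x []|].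
  by rewrite lebesgue_cube// expr0 mul1r.
have [k0 hole] := @frontier_porous _ _ C a r cC r0.
have r9 : 0 < r / 9 by rewrite divr_gt0.
have [B HB] := choice (fun k => IHj (subcube_corner a r k) (r / 9) r9).
have mB k : measurable (B k) by have [] := HB k.
have [mU leU] := @measure_bigsetU_le _ _ _ mu _ (fun k => k != k0) B mB.
exists (\big[setU/set0]_(k | k != k0) B k); split => //.
  move=> x [Fx ax]; have [k kx] := cube_subdivision r0 ax.
  have kk0 : k != k0.
    by apply/eqP => kE; rewrite -kE in hole; rewrite -[False]/(set0 x) -hole.
  rewrite (bigD1 k)//=; left.
  by have [_ + _] := HB k; apply.
apply: le_trans leU _.
apply: (@le_trans _ _ (\sum_(k | k != k0)
    ((1 - (9 ^+ n)^-1) ^+ j * (r / 9) ^+ n)%:E)%E).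
  by apply: lee_sum => k _; have [] := HB k.
rewrite sumEFin lee_fin sumr_const cardC1 card_ffun !card_ord.
have n9 : (9 ^ n).-1%:R = 9 ^+ n - 1 :> R.
  by rewrite -subn1 natrB ?expn_gt0// natrX.
rewrite -[leLHS]mulr_natr n9 expr_div_n exprS.
by rewrite le_eqVlt; apply/orP; left; apply/eqP; field; rewrite expf_neq0.
Qed.

(** In each cube, the covers given by the successive refinements have a null
    intersection. *)
Lemma negligible_frontier C : convex_set (C : set (convex_lmodType 'rV[R]_n)) ->
  mu.-negligible (frontier C).
Proof.
move=> cC; pose a (m : nat) : 'rV[R]_n := const_mx (- m%:R).
have FE : frontier C `<=` \bigcup_m (frontier C `&` cube (a m) (m%:R *+ 2 + 1)).
  move=> x Fx; exists (Num.truncn `|x|).+1 => //; split=> // i.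
  rewrite mxE; set m := _.+1%:R.
  have : `|x 0 i| < m.
    apply: le_lt_trans (truncnS_gt _).
    rewrite [leRHS]/Num.norm/= mx_normrE.
    by rewrite (le_trans _ (le_bigmax _ _ (0, i))).
  by rewrite ltr_norml => /andP[? ?]; apply/andP; split; lra.
apply: negligibleS FE _; apply: negligible_bigcup => m.
set r := _ + 1; have r0 : 0 < r by rewrite ltr_wpDl// mulrn_wge0.
have [B HB] := choice (fun j => @frontier_cover C cC j (a m) r r0).
have mB j : measurable (B j) by have [] := HB j.
have mI : measurable (\bigcap_j B j) by exact: bigcapT_measurable.
exists (\bigcap_j B j); split => //; last first.
  by move=> x Fx j _; have [_ + _] := HB j; apply.
apply/eqP; rewrite -measure_le0; apply/lee_addgt0Pr => e e0; rewrite add0e.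
pose u (j : nat) := (1 - (9 ^+ n)^-1) ^+ j * r ^+ n.
have u0 : u @ \oo --> (0 : R).
  rewrite -[X in _ --> X](mul0r (r ^+ n)); apply: cvgMl => //.
  apply: cvg_expr; rewrite ger0_norm; last first.
    by rewrite subr_ge0 invf_le1 ?exprn_gt0// exprn_ege1// ler1n.
  by rewrite gtrBl invr_gt0 exprn_gt0.
have [j _ uj] : \forall j \near \oo, u j < e.
  by apply: cvgr_lt u0 _ _.
have [_ _ Bj] := HB j; apply: (@le_trans _ _ (mu (B j))).
  by apply: le_measure; rewrite ?inE//; exact: bigcap_inf.
by apply: le_trans Bj _; rewrite lee_fin ltW// uj /=.
Qed.

End null_frontier.

(** * Integrals and null sets *)

Section null_sets.
Context d (T : measurableType d) (R : realType).
Variable mu : {measure set T -> \bar R}.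
Implicit Types (f g : T -> \bar R) (D E N : set T).
Import HBNNSimple.

Let le_lower_integral N f g : measurable N -> mu N = 0%E ->
  (forall x, (0 <= g x)%E) -> (forall x, ~ N x -> f x = g x) ->
  (ereal_sup [set sintegral mu h | h in
     [set h : {nnsfun T >-> R} | forall x, ((h x)%:E <= f x)%E]] <=
   ereal_sup [set sintegral mu h | h in
     [set h : {nnsfun T >-> R} | forall x, ((h x)%:E <= g x)%E]])%E.
Proof.
move=> mN N0 g0 fg; apply: ge_ereal_sup => _ [h /= hf <-].
have mNC : measurable (~` N) by exact: measurableC.
apply: ereal_sup_ubound; exists (proj_nnsfun h mNC) => /=.
  move=> x; rewrite /= mindicE; case: (boolP (x \in ~` N)).
    by rewrite inE => /= Nx; rewrite mulr1 -fg.
  by rewrite mulr0.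
rewrite -!integralT_nnsfun.
have mh : measurable_fun setT (EFin \o h) by exact/measurable_EFinP.
rewrite [RHS](@ge0_negligible_integral _ _ _ mu setT N)//=; last first.
  by move=> x _; rewrite lee_fin.
rewrite setTD [RHS]integral_mkcond; apply: eq_integral => x _.
rewrite patchE mindicE; case: ifP => _; first by rewrite mulr1.
by rewrite mulr0.
Qed.

(** The integral of a nonnegative function, measurable or not, is the supremum
    of the integrals of the simple functions below it, and these keep the same
    integral when set to zero on [N]. This generality is what allows the
    integrands to be arbitrary on the frontier of the supports. *)
Lemma eq_integral_null N D E f g : measurable N -> mu N = 0%E ->
  (forall x, ~ N x -> (f \_ D) x = (g \_ E) x) ->
  (\int[mu]_(x in D) f x = \int[mu]_(x in E) g x)%E.
Proof.
move=> mN N0 fg.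
rewrite integral_mkcond [RHS]integral_mkcond /integral !patch_setT.
congr (_ - _)%E; apply/eqP; rewrite eq_le; apply/andP; split;
  apply: (le_lower_integral mN N0) => x;
  rewrite ?funeposE ?funenegE ?le_max ?lexx ?orbT//;
  by move=> Nx; rewrite fg.
Qed.

End null_sets.

(** * Jets of the maximum and of the minimum *)

Section jets.
Context {R : realType} {n : nat}.
Implicit Types (phi psi : 'rV[R]_n -> R) (x : 'rV[R]_n).

(** Agreement of the data on which the integrand of the divergence depends. *)
Definition same_jet phi psi x := [/\ phi x = psi x,
  gradient phi x = gradient psi x & hessian phi x = hessian psi x].

Lemma fdiv_integrand_jet s f phi psi x :
  same_jet phi psi x -> fdiv_integrand s f phi x = fdiv_integrand s f psi x.
Proof.
case=> e0 e1 e2.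
by rewrite /fdiv_integrand /density_ratio /curvature_mx /weight e0 e1 e2.
Qed.

Lemma near_eq_gradient phi psi x :
  (\near x, phi x = psi x) -> gradient phi x = gradient psi x.
Proof. by move=> e; apply/rowP => i; rewrite !mxE; exact: near_eq_derive. Qed.

Lemma near_eq_jet phi psi x :
  (\near x, phi x = psi x) -> same_jet phi psi x.
Proof.
move=> e; split; first exact: nbhs_singleton e.
  exact: near_eq_gradient.
apply/matrixP => i j; rewrite [LHS]mxE [RHS]mxE.
have eg : \near x, pderive i phi x = pderive i psi x.
  apply: filterS (near_join e) => y /near_eq_gradient /rowP /(_ i).
  by rewrite [LHS]mxE [RHS]mxE.
exact: near_eq_derive eg.
Qed.

Lemma eq_closure (T : topologicalType) (V : normedModType R) (P : set T)
    (a b : T -> V) (x : T) :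
  {for x, continuous a} -> {for x, continuous b} -> closure P x ->
  (forall y, P y -> a y = b y) -> a x = b x.
Proof.
move=> ca cb clP ab; apply: norm_hausdorff => A B aA bB.
have nA : nbhs x (a @^-1` A) by exact: ca.
have nB : nbhs x (b @^-1` B) by exact: cb.
have [y [Py [Ay By]]] := clP _ (filterI nA nB).
by exists (a y); split => //; rewrite ab.
Qed.

Lemma C2_on_jet_closure U (P : set 'rV[R]_n) phi psi x :
  C2_on U phi -> C2_on U psi -> U x -> closure P x ->
  (forall y, P y -> same_jet phi psi y) -> same_jet phi psi x.
Proof.
move=> Cphi Cpsi Ux clP e.
have [d0 d1 d2] := Cphi _ Ux; have [d0' d1' d2'] := Cpsi _ Ux.
split.
- apply: (eq_closure (differentiable_continuous d0)
    (differentiable_continuous d0') clP).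
  by move=> y /e [? _ _].
- apply: (eq_closure (differentiable_continuous d1)
    (differentiable_continuous d1') clP).
  by move=> y /e [_ ? _].
- by apply: (eq_closure d2 d2' clP) => y /e [_ _ ?].
Qed.

(** At a point of the closure of the open set where [phi2 < phi1], continuity
    transports there the equality of the jets of [max] and [phi1], and of [min]
    and [phi2]; at any other point [phi1 <= phi2] holds in a neighbourhood. *)
Lemma jet_max_min U phi1 phi2 x :
  let phi_max := fun x => Num.max (phi1 x) (phi2 x) in
  let phi_min := fun x => Num.min (phi1 x) (phi2 x) in
  open U -> C2_on U phi1 -> C2_on U phi2 ->
  C2_on U phi_max -> C2_on U phi_min -> U x ->
  (same_jet phi_max phi1 x /\ same_jet phi_min phi2 x) \/
  (same_jet phi_max phi2 x /\ same_jet phi_min phi1 x).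
Proof.
move=> phi_max phi_min oU C1 C2 CM Cm Ux.
pose P := U `&` [set y | phi2 y < phi1 y].
have Pnear y : P y -> \near y, phi2 y < phi1 y.
  move=> [Uy]; rewrite /= => lty.
  have [/differentiable_continuous c1 _ _] := C1 _ Uy.
  have [/differentiable_continuous c2 _ _] := C2 _ Uy.
  pose m := (phi1 y + phi2 y) / 2.
  have m1 : m < phi1 y by rewrite /m; lra.
  have m2 : phi2 y < m by rewrite /m; lra.
  near=> z; apply: (@lt_trans _ _ m); near: z.
    exact: (cvgr_lt _ c2).
  exact: (cvgr_gt _ c1).
have [clP|nclP] := pselect (closure P x).
  left; split; [apply: (C2_on_jet_closure CM C1 Ux clP)|
                apply: (C2_on_jet_closure Cm C2 Ux clP)] => y /Pnear lty;
    apply: near_eq_jet; apply: filterS lty => z ltz.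
    by rewrite /phi_max max_l// ltW.
  by rewrite /phi_min min_r// ltW.
right.
have le12 : \near x, phi1 x <= phi2 x.
  move/existsNP : nclP => [B /not_implyP[xB PB]].
  apply: filterS (filterI xB (open_nbhs_nbhs (conj oU Ux))) => y [By Uy].
  by rewrite leNgt; apply/negP => lty; apply: PB; exists y.
split; apply: near_eq_jet; apply: filterS le12 => y ley.
  by rewrite /phi_max max_r.
by rewrite /phi_min min_l.
Unshelve. all: by end_near. Qed.

End jets.

(** * Composition with a linear map *)

Section linear_composition.
Context {R : realType} {n : nat}.
Implicit Types (phi : 'rV[R]_n -> R) (x v : 'rV[R]_n).

Lemma derive_delta_mx phi x v : differentiable phi x ->
  'D_v phi x = \sum_l v 0 l * 'D_(delta_mx 0 l) phi x.
Proof.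
move=> dphi; rewrite deriveE// {1}(row_sum_delta v) linear_sum.
by apply: eq_bigr => l _; rewrite linearZ/= -deriveE.
Qed.

Variable A : {linear 'rV[R]_n -> 'rV[R]_n}.
Let M := lin1_mx A.

Lemma derive_comp_linear phi x v : 'D_v (phi \o A) x = 'D_(A v) phi (A x).
Proof.
rewrite /derive; set F := (X in lim (X @ _)); set G := (X in _ = lim (X @ _)).
suff -> : F = G by [].
by apply/funext => h; rewrite /F /G/= [A (_ + _)]linearD [A (_ *: _)]linearZ.
Qed.

Lemma linear_rV_continuous : continuous A.
Proof.
rewrite (_ : A = (fun x => \sum_(i < n) x 0 i *: A (delta_mx 0 i)) :> (_ -> _)).
  move=> x; apply: cvg_big.
  - exact: add_continuous.
  - exact: nbhs_filter.
  - move=> i _; apply: cvgZr_tmp; first exact: nbhs_filter.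
    exact: coord_continuous.
apply/funext => x; rewrite {1}[x]row_sum_delta linear_sum.
by under eq_bigr do rewrite linearZ.
Qed.

Lemma gradient_comp_linear phi x : differentiable phi (A x) ->
  gradient (phi \o A) x = gradient phi (A x) *m M^T.
Proof.
move=> dphi; apply/rowP => i; rewrite !mxE.
rewrite [LHS]derive_comp_linear derive_delta_mx//.
by apply: eq_bigr => l _; rewrite !mxE mulrC.
Qed.

Lemma hessian_comp_linear U phi x : open U -> C2_on U phi -> U (A x) ->
  hessian (phi \o A) x = M *m hessian phi (A x) *m M^T.
Proof.
move=> oU Cphi UAx; apply/matrixP => i j; rewrite mxE.
(* [F] is the [i]-th coordinate of [gradient phi *m M^T]. *)
pose F := \sum_(l < n) (M i l \*: (pderive l phi : 'rV[R]_n -> R^o)).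
have FE y : F y = \sum_l M i l * pderive l phi y by rewrite /F fct_sumE.
have [_ dg _] := Cphi _ UAx.
have dpd l : differentiable (pderive l phi) (A x).
  rewrite (_ : pderive l phi = (fun N : 'rV[R]_n => N 0 l) \o gradient phi).
    by apply: differentiable_comp => //; exact: differentiable_coord.
  by apply/funext => y; rewrite /= mxE.
transitivity ('D_(delta_mx 0 j) (F \o A) x).
  apply: near_eq_derive.
  have : nbhs x (A @^-1` U).
    by apply: linear_rV_continuous; exact: open_nbhs_nbhs.
  apply: filterS => y /= /Cphi [dphi _ _]; rewrite FE.
  rewrite [LHS]derive_comp_linear derive_delta_mx//.
  by apply: eq_bigr => l _; rewrite !mxE.
rewrite derive_comp_linear derive_delta_mx; last first.
  by apply: differentiable_sum => l; exact: differentiableZ.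
rewrite mxE; apply: eq_bigr => k _; rewrite !mxE mulrC; congr (_ * _).
rewrite derive_sum; last first.
  by move=> l; apply: derivableZ; exact: diff_derivable.
apply: eq_bigr => l _; rewrite deriveZ; last exact: diff_derivable.
by rewrite !mxE.
Qed.

Lemma fdiv_integrand_comp_linear s f U phi x :
  det_linear A = 1 -> open U -> C2_on U phi -> U (A x) ->
  fdiv_integrand s f (phi \o A) x = fdiv_integrand s f phi (A x).
Proof.
move=> detA oU Cphi UAx.
have [dphi _ _] := Cphi _ UAx.
have gE := gradient_comp_linear dphi.
have wE : weight s (phi \o A) x = weight s phi (A x).
  rewrite /weight gE; congr (1 - s * (_ / _)).
  rewrite /dot.
  transitivity ((gradient phi (A x) *m M^T *m x^T) 0 0).
    by rewrite mxE; apply: eq_bigr => i _; rewrite [x^T _ _]mxE.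
  rewrite -mulmxA -trmx_mul mxE; apply: eq_bigr => i _.
  by rewrite [_^T _ _]mxE [x *m M]mul_rV_lin1.
have cE : \det (curvature_mx s (phi \o A) x) = \det (curvature_mx s phi (A x)).
  suff -> : curvature_mx s (phi \o A) x = M *m curvature_mx s phi (A x) *m M^T.
    by rewrite !det_mulmx det_tr [\det M]detA mul1r mulr1.
  rewrite /curvature_mx gE (hessian_comp_linear oU Cphi UAx).
  rewrite mulmxDr mulmxDl -!scalemxAr -!scalemxAl mulmxN mulNmx trmx_mul trmxK.
  by rewrite !mulmxA.
have phiE : (phi \o A) x = phi (A x) by [].
by rewrite /fdiv_integrand /density_ratio phiE wE cE.
Qed.

End linear_composition.

(** * The divergence *)

Section divergence.
Context {R : realType} {n : nat}.
Local Notation mu := (lebesgue_rV R n).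
Implicit Types (phi : 'rV[R]_n -> R) (s : R) (f : R -> R).

Lemma convex_supp s phi : s_concave s phi ->
  convex_set (supp phi : set (convex_lmodType 'rV[R]_n)).
Proof.
move=> [_ cphi]; apply/convex_setP => l x y l01 px py.
apply: lt_le_trans (cphi l x y l01 px py); apply: powR_gt0.
have xs : 0 < phi x `^ s by exact: powR_gt0.
have ys : 0 < phi y `^ s by exact: powR_gt0.
by case/andP: l01 => l0 l1; nra.
Qed.

Lemma measurable_supp phi :
  mu.-integrable setT (EFin \o phi) -> measurable (supp phi).
Proof.
move=> /measurable_int mphi.
have := emeasurable_fun_o_infty measurableT mphi 0%E; rewrite setTI.
by congr measurable.
Qed.

Lemma integral_comp_measure_preserving (T : 'rV[R]_n -> 'rV[R]_n)
    (h : 'rV[R]_n -> \bar R) : measurable_fun setT T ->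
  (forall B, measurable B -> mu (T @^-1` B) = mu B) -> measurable_fun setT h ->
  (\int[mu]_x h (T x) = \int[mu]_x h x)%E.
Proof.
move=> mT pT mh.
have ge0E (g : 'rV[R]_n -> \bar R) : measurable_fun setT g ->
    (forall x, 0 <= g x)%E -> (\int[mu]_x g (T x) = \int[mu]_x g x)%E.
  move=> mg g0.
  rewrite -[LHS](@ge0_integral_pushforward _ _ _ _ _ _ mT mu setT g)//.
  by apply: eq_measure_integral => B mB _; exact: pT.
rewrite [LHS]integralE [RHS]integralE; congr (_ - _)%E.
  rewrite -[RHS]ge0E//; [|exact: measurable_funepos].
  by apply: eq_integral => x _; rewrite !funeposE.
rewrite -[RHS]ge0E//; [|exact: measurable_funeneg].
by apply: eq_integral => x _; rewrite !funenegE.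
Qed.

Lemma fdiv_comp_linear s f phi (A : {linear 'rV[R]_n -> 'rV[R]_n}) :
  s_concave s phi -> regular s f phi -> det_linear A = 1 ->
  fdiv s f (phi \o A) = fdiv s f phi.
Proof.
move=> cphi [iphi Cphi intphi] detA.
have AE : (A : _ -> _) = (fun x => x *m lin1_mx A).
  by apply/funext => x; rewrite mul_rV_lin1.
have mA : measurable_fun setT A by rewrite AE; exact: measurable_mulmx.
have pA B : measurable B -> mu (A @^-1` B) = mu B.
  move=> mB; rewrite AE scales_lebesgue_unit//; last first.
    by rewrite [\det _]detA oner_neq0.
  by rewrite [\det _]detA normr1 invr1 mul1e.
have mS := measurable_supp iphi.
have [N [mN N0 FN]] := negligible_frontier (convex_supp cphi).
pose g := fdiv_integrand s f phi \_ (supp phi).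
have mg : measurable_fun setT g.
  by apply/(measurable_restrictT _ mS); exact: measurable_int intphi.
rewrite /fdiv [RHS]integral_mkcond.
rewrite -[RHS](integral_comp_measure_preserving mA pA mg).
apply: (@eq_integral_null _ _ _ mu (A @^-1` N)).
- by rewrite -[X in measurable X]setTI; exact: mA.
- exact: etrans (pA _ mN) N0.
move=> x NAx; rewrite patch_setT /g !patchE.
rewrite (_ : (x \in supp (phi \o A)) = (A x \in supp phi)); last first.
  by apply/idP/idP; rewrite !inE.
case: ifPn => // /set_mem Sx.
apply: (@fdiv_integrand_comp_linear _ _ _ _ _ (supp phi)°) => //.
  exact: open_interior.
apply: contrapT => nx; apply: NAx; apply: FN; split => //.
exact: subset_closure.
Qed.

Lemma frontierNP (C : set 'rV[R]_n) x : ~ frontier C x ->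
  C° x \/ ~ closure C x.
Proof.
move=> nF; have [Cx|nCx] := pselect (C° x); [by left|right => clx].
by apply: nF.
Qed.

Lemma fdiv_valuation s f phi1 phi2 :
  let phi_max := fun x => Num.max (phi1 x) (phi2 x) in
  let phi_min := fun x => Num.min (phi1 x) (phi2 x) in
  s_concave s phi1 -> s_concave s phi2 ->
  regular s f phi1 -> regular s f phi2 ->
  regular s f phi_max -> regular s f phi_min ->
  (fdiv s f phi1 + fdiv s f phi2 = fdiv s f phi_max + fdiv s f phi_min)%E.
Proof.
move=> phi_max phi_min c1 c2 [i1 C1 int1] [i2 C2 int2].
move=> [iM CM intM] [im Cm intm].
pose g phi := fdiv_integrand s f phi \_ (supp phi).
have gE phi : fdiv s f phi = (\int[mu]_x g phi x)%E.
  by rewrite /fdiv integral_mkcond.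
have ig phi : mu.-integrable setT (EFin \o phi) ->
    mu.-integrable (supp phi) (fdiv_integrand s f phi) ->
    mu.-integrable setT (g phi).
  by move=> /measurable_supp mS; rewrite integrable_mkcond.
rewrite !gE -!integralD ?ig//.
have [N1 [mN1 N10 FN1]] := negligible_frontier (convex_supp c1).
have [N2 [mN2 N20 FN2]] := negligible_frontier (convex_supp c2).
apply: (@eq_integral_null _ _ _ mu (N1 `|` N2)).
- exact: measurableU.
- by rewrite measureU0.
move=> x /not_orP[nN1 nN2]; rewrite !patch_setT.
have {nN1} x1 : (supp phi1)° x \/ ~ closure (supp phi1) x.
  by apply: frontierNP => /FN1.
have {nN2} x2 : (supp phi2)° x \/ ~ closure (supp phi2) x.
  by apply: frontierNP => /FN2.
have g_jet phi psi : same_jet phi psi x -> g phi x = g psi x.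
  move=> e; rewrite /g !patchE (fdiv_integrand_jet _ _ e); case: e => e _ _.
  by rewrite (_ : (x \in supp phi) = (x \in supp psi))//; apply/idP/idP;
    rewrite !inE /supp /= e.
have g_out phi : ~ supp phi x -> g phi x = 0%E.
  by move=> Sx; rewrite /g patchE memNset.
have near0 phi : s_concave s phi -> ~ closure (supp phi) x ->
    \near x, phi x = 0.
  move=> [phi0 _] /existsNP[B /not_implyP[xB SB]].
  apply: filterS xB => y By; apply/eqP; rewrite eq_le phi0 andbT leNgt.
  by apply/negP => py; apply: SB; exists y.
have outS phi : ~ closure (supp phi) x -> ~ supp phi x.
  by move=> + Sx; apply; exact: subset_closure.
case: x1 => [x1|nx1]; [case: x2 => [x2|nx2]|].
- pose U := (supp phi1)° `&` (supp phi2)°.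
  have oU : open U by apply: openI; exact: open_interior.
  have UM : U `<=` (supp phi_max)°.
    move=> y [y1 _]; apply: interiorS y1 => z.
    by rewrite /supp /= /phi_max lt_max => ->.
  have Um : U `<=` (supp phi_min)°.
    rewrite (_ : supp phi_min = supp phi1 `&` supp phi2) ?interiorI//.
    by apply/seteqP; split => z; rewrite /supp /= /phi_min lt_min => /andP.
  have [] := @jet_max_min _ _ U phi1 phi2 x oU.
  + by move=> y [/C1].
  + by move=> y [_ /C2].
  + by move=> y /UM/CM.
  + by move=> y /Um/Cm.
  + by [].
  + by move=> [/g_jet -> /g_jet ->].
  + by move=> [/g_jet -> /g_jet ->]; rewrite addeC.
- have /g_jet -> : same_jet phi_max phi1 x.
    apply: near_eq_jet; apply: filterS (near0 _ c2 nx2) => y y0.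
    by rewrite /phi_max y0 max_l// c1.1.
  have -> : g phi2 x = 0%E by apply: g_out; exact: outS.
  have -> : g phi_min x = 0%E.
    apply: g_out; rewrite /supp /= /phi_min lt_min => /andP[_].
    exact: outS.
  by [].
- have /g_jet -> : same_jet phi_max phi2 x.
    apply: near_eq_jet; apply: filterS (near0 _ c1 nx1) => y y0.
    by rewrite /phi_max y0 max_r// c2.1.
  have -> : g phi1 x = 0%E by apply: g_out; exact: outS.
  have -> : g phi_min x = 0%E.
    apply: g_out; rewrite /supp /= /phi_min lt_min => /andP[+ _].
    exact: outS.
  by rewrite addeC.
Qed.

End divergence.

Theorem lemma6 (R : realType) (n : nat) (s : R) (f : R -> R)
    (s_neq0 : s != 0) (f_conv : convex_or_concave f) :
  (forall (phi : 'rV[R]_n -> R) (A : {linear 'rV[R]_n -> 'rV[R]_n}),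
     s_concave s phi -> regular s f phi ->
     self_adjoint A -> det_linear A = 1 ->
     fdiv s f (phi \o A) = fdiv s f phi) /\
  (forall phi1 phi2 : 'rV[R]_n -> R,
     let phi_max := fun x => Num.max (phi1 x) (phi2 x) in
     let phi_min := fun x => Num.min (phi1 x) (phi2 x) in
     s_concave s phi1 -> s_concave s phi2 -> s_concave s phi_max ->
     regular s f phi1 -> regular s f phi2 ->
     regular s f phi_max -> regular s f phi_min ->
     (fdiv s f phi1 + fdiv s f phi2 = fdiv s f phi_max + fdiv s f phi_min)%E).
Proof.
split=> [phi A cphi rphi _ detA|phi1 phi2 phi_max phi_min c1 c2 _ r1 r2 rM rm].
  exact: fdiv_comp_linear.
exact: fdiv_valuation.
Qed.
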